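(* Let $r$ be a nonnegative integer. For every integer $n\geq 0$, we have $$B^{(c,r)}_n(x)=\sum_{l=0}^n\binom{n}{l}B^{(c)}_{n-l}(x)\,r^l.$$
   Context: The central Bell polynomials $B^{(c)}_n(x)$ are defined by the formal power series identity (in $t$) $e^{x\left(e^{t/2}-e^{-t/2}\right)}=\sum_{n=0}^\infty B^{(c)}_n(x)\frac{t^n}{n!}$. For a nonnegative integer $r$, the extended $r$-central Bell polynomials $B^{(c,r)}_n(x)$ are defined by the formal power series identity (in $t$) $$e^{rt}e^{x\left(e^{t/2}-e^{-t/2}\right)}=\sum_{n=0}^\infty B^{(c,r)}_n(x)\frac{t^n}{n!}.$$ Convention: $0^0=1$. *)

(* Defs.v *)
From mathcomp Require Import all_boot all_order all_algebra.

Set Implicit Arguments.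
Unset Strict Implicit.
Unset Printing Implicit Defensive.

Import GRing.Theory Num.Theory.
Local Open Scope ring_scope.

(* Formal power series in t over A, as coefficient sequences: f stands for
   the series with coefficient f n at t^n. *)
Definition fps (A : Type) : Type := nat -> A.

Section FormalPowerSeries.

Variables (F : numFieldType) (A : comAlgType F).
Implicit Types (f g : fps A) (a : A).

Definition fps_one : fps A := fun n => (n == 0%N)%:R.

Definition fps_var : fps A := fun n => (n == 1%N)%:R.

Definition fps_sub f g : fps A := fun n => f n - g n.

Definition fps_scale a f : fps A := fun n => a * f n.

Definition fps_mul f g : fps A := fun n => \sum_(i < n.+1) f i * g (n - i)%N.

Definition fps_pow f (k : nat) : fps A := iter k (fps_mul f) fps_one.

(* The substitution f(g(t)), meaningful only when g 0 = 0: then t^k divides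
   g^k, so only the terms with k <= n contribute to the coefficient of t^n. *)
Definition fps_comp f g : fps A :=
  fun n => \sum_(k < n.+1) f k * fps_pow g k n.

(* The series sum_n u_n t^n / n! *)
Definition fps_egf (u : nat -> A) : fps A := fun n => (n`!%:R^-1 : F) *: u n.

Definition fps_exp g : fps A := fps_comp (fps_egf (fun=> 1)) g.

End FormalPowerSeries.

Section CentralBell.

Variable F : numFieldType.

Notation t := (fps_var {poly F}).

(* e^(t/2) - e^(-t/2) *)
Definition central_series : fps {poly F} :=
  fps_sub (fps_exp (fps_scale (2^-1)%:P t)) (fps_exp (fps_scale (- 2^-1)%:P t)).

(* The indeterminate x is 'X. *)
Definition central_bell_gf : fps {poly F} :=
  fps_exp (fps_scale 'X central_series).

Definition r_central_bell_gf (r : nat) : fps {poly F} :=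
  fps_mul (fps_exp (fps_scale r%:R t)) central_bell_gf.

Definition central_bell (n : nat) : {poly F} :=
  (n`!%:R : F) *: central_bell_gf n.

Definition r_central_bell (r n : nat) : {poly F} :=
  (n`!%:R : F) *: r_central_bell_gf r n.

Lemma central_series0 : central_series 0 = 0.
Proof. by rewrite /central_series /fps_sub /fps_exp /fps_comp !big_ord1 subrr. Qed.

Lemma central_bell_gfE : fps_egf central_bell =1 central_bell_gf.
Proof.
by move=> n; rewrite /fps_egf scalerA mulVf ?scale1r // pnatr_eq0 -lt0n fact_gt0.
Qed.

Lemma r_central_bell_gfE r : fps_egf (r_central_bell r) =1 r_central_bell_gf r.
Proof.
by move=> n; rewrite /fps_egf scalerA mulVf ?scale1r // pnatr_eq0 -lt0n fact_gt0.
Qed.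

End CentralBell.

(* Main.v *)
Require Import Defs.
From mathcomp Require Import all_boot all_order all_algebra.

Import GRing.Theory Num.Theory.
Local Open Scope ring_scope.

(** The generating function is the Cauchy product of [e^(rt)] with that of the central Bell
    polynomials. By [fps_exp_scale_var] the first factor has coefficients [r^l / l!], so multiplying
    the coefficient of [t^n] by [n!] leaves the weights [n! / l! = 'C(n, l) * (n - l)!]. *)

Lemma fps_pow_scale_var (F : numFieldType) (A : comAlgType F) (a : A)
    (k n : nat) :
  fps_pow (fps_scale a (fps_var A)) k n = (n == k)%:R * a ^+ k.
Proof.
elim: k n => [|k IHk] n; first by rewrite mulr1.
rewrite /fps_pow iterS -/(fps_pow _ _) /fps_mul /fps_scale /fps_var.
case: n => [|n]; first by rewrite big_ord1 mulr0 !mul0r.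
(* Only index 1 of the convolution survives, since [a * t] has no other coefficient. *)
rewrite 2!big_ord_recl big1 => [|i _]; last by rewrite mulr0 mul0r.
by rewrite mulr0 mul0r add0r addr0 mulr1 IHk subSS subn0 eqSS mulrCA -exprS.
Qed.

(** Since [(a t)^k] is a monomial of degree [k], only the last term, [k = n], of the truncated
    composition contributes. *)
Lemma fps_exp_scale_var (F : numFieldType) (A : comAlgType F) (a : A)
    (n : nat) :
  fps_exp (fps_scale a (fps_var A)) n = (n`!%:R^-1 : F) *: a ^+ n.
Proof.
rewrite /fps_exp /fps_comp /fps_egf big_ord_recr /= big1 => [|i _].
  by rewrite add0r fps_pow_scale_var eqxx mul1r -scalerAl mul1r.
by rewrite fps_pow_scale_var gtn_eqF // mul0r mulr0.
Qed.

Theorem theorem2p7 (F : numFieldType) (r n : nat) :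
  r_central_bell F r n =
    \sum_(0 <= l < n.+1) 'C(n, l)%:R * central_bell F (n - l) * r%:R ^+ l.
Proof.
rewrite big_mkord /r_central_bell /r_central_bell_gf /fps_mul scaler_sumr.
apply: eq_bigr => l _; rewrite fps_exp_scale_var /central_bell.
have le_ln : (l <= n)%N by rewrite -ltnS.
have l_neq0 : l`!%:R != 0 :> F by rewrite pnatr_eq0 -lt0n fact_gt0.
(* Writing [n!] as [l! * ('C(n, l) * (n - l)!)] lets [l!] cancel the denominator coming from
   [e^(rt)]; the factor [(n - l)!] is the one in [central_bell]. *)
rewrite -(bin_fact le_ln) mulnCA !natrM -scalerAl scalerA mulrAC mulfV // mul1r.
rewrite -scalerAr -scalerAl -scalerA !scaler_nat.
by rewrite mulr_natl mulrnAl mulrnAC (mulrC (r%:R ^+ l)).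
Qed.
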